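(* Suppose that $r\in(1,\infty]$ and that $b,c$ are positive real numbers with $R_0/(1-\beta)<c<b$. The following hold: (i) there exist a constant $C$ and a nonnegative integer $N$, depending only on $M$, $b$ and $c$, such that for each ball $B\in\mathcal{B}_b$ and each $(1,r)$-atom $a$ supported in $B$ there exist at most $N$ $(1,r)$-atoms $a_1,\ldots,a_N$ with supports contained in balls $B_1,\ldots,B_N$ in $\mathcal{B}_c$ and $N$ constants $\lambda_1,\ldots,\lambda_N$ such that $|\lambda_j|\le C$, $$a=\sum_{j=1}^N\lambda_j\,a_j\qquad\text{and}\qquad \|a\|_{H_c^{1,r}(\mu)}\le C\,N;$$ (ii) a function $f$ is in $H_c^{1,r}(\mu)$ if and only if $f$ is in $H_b^{1,r}(\mu)$. Furthermore, there exists a constant $C$ such that $$\|f\|_{H_b^{1,r}(\mu)}\le\|f\|_{H_c^{1,r}(\mu)}\le C\,\|f\|_{H_b^{1,r}(\mu)}\qquad\text{for all } f\in H_c^{1,r}(\mu).$$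
   Context: Setting. $(M,\rho,\mu)$ is a metric measure space ($\mu$ a Borel measure), $M$ is unbounded, $\mu(M)>0$ and every ball has finite measure. $\mathcal{B}$ is the family of all balls of $M$; $c_B$, $r_B$ are the centre and radius of $B\in\mathcal{B}$, $\kappa B$ is the ball with centre $c_B$ and radius $\kappa r_B$; for $b>0$, $\mathcal{B}_b$ is the family of balls with $r_B\le b$. For $A\subset M$ and $\kappa>0$, $A_\kappa=\{x\in A:\rho(x,A^c)\le\kappa\}$. It is assumed that $M$ has the following three properties. Local doubling property (LDP): for every $b>0$ there is a constant $D_b$ such that $\mu(2B)\le D_b\,\mu(B)$ for all $B\in\mathcal{B}_b$. Isoperimetric property (I): there exist $\kappa_0,C>0$ such that for every bounded open set $A$, $\mu(A_\kappa)\ge C\kappa\,\mu(A)$ for all $\kappa\in(0,\kappa_0]$. Approximate midpoint property (AMP): there exist $R_0\in[0,\infty)$ and $\beta\in(1/2,1)$ such that for every pair of points $x,y\in M$ with $\rho(x,y)>R_0$ there is a ball $B$ containing $x$ and $y$ with $r_B<\beta\,\rho(x,y)$. The constants $R_0,\beta$ are fixed. Atoms. For $r\in(1,\infty]$, a $(1,r)$-atom $a$ is a function in $L^1(\mu)$ supported in a ball $B\in\mathcal{B}$ with $\int_B a\,d\mu=0$ and $\bigl(\frac1{\mu(B)}\int_B|a|^r\,d\mu\bigr)^{1/r}\le\mu(B)^{-1}$ if $r<\infty$, respectively $\|a\|_\infty\le\mu(B)^{-1}$ if $r=\infty$. Hardy space. For $b>0$, $H_b^{1,r}(\mu)$ is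 the space of all $g\in L^1(\mu)$ admitting a decomposition $g=\sum_{k=1}^\infty\lambda_k a_k$, where each $a_k$ is a $(1,r)$-atom supported in a ball of $\mathcal{B}_b$ and $\sum_k|\lambda_k|<\infty$; $\|g\|_{H_b^{1,r}(\mu)}$ is the infimum of $\sum_k|\lambda_k|$ over all such decompositions. *)

(* Defs.v *)
From HB Require Import structures.
From mathcomp Require Import all_boot all_order all_algebra.
From mathcomp Require Import all_classical all_reals all_analysis.

Set Implicit Arguments.
Unset Strict Implicit.
Unset Printing Implicit Defensive.

Import Order.TTheory GRing.Theory Num.Theory.
Import numFieldNormedType.Exports.

Local Open Scope classical_set_scope.
Local Open Scope ring_scope.

#[short(type="metricMeasurableType")]
HB.structure Definition MetricMeasurable (R : numDomainType) (d : measure_display) :=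
  { M of Metric R M & Measurable d M }.

(* Nothing in the structure relates measurable sets to the metric; this does. *)
Definition borel_space (R : realType) d (M : metricMeasurableType R d) : Prop :=
  (@measurable d M) = <<s [set A : set M | open A] >>.

Section MetricMeasure.
Context {R : realType} {d : measure_display} {M : metricMeasurableType R d}.

Definition dbounded (A : set M) : Prop :=
  exists K : R, forall x y, A x -> A y -> mdist x y <= K.

(* The distance to the empty set is +oo. *)
Definition dist_to (A : set M) (x : M) : \bar R :=
  ereal_inf [set (mdist x y)%:E | y in A].

Definition inner_collar (A : set M) (kappa : R) : set M :=
  [set x | A x /\ (dist_to (~` A) x <= kappa%:E)%E].

Definition approx_midpoint (R0 beta : R) : Prop :=
  forall x y : M, R0 < mdist x y ->
  exists (z : M) (s : R),
    [/\ 0 < s, ball z s x, ball z s y & s < beta * mdist x y].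

Variable mu : {measure set M -> \bar R}.

(* The family of balls of radius at most b is the set of pairs (x, s) with
   0 < s <= b: a ball carries its centre and radius, which the underlying
   (open) point set need not determine. *)
Definition locally_doubling : Prop :=
  forall b : R, 0 < b -> exists D : R, forall (x : M) (s : R),
    0 < s <= b -> (mu (ball x (2 * s)) <= D%:E * mu (ball x s))%E.

Definition isoperimetric : Prop :=
  exists kappa0 C : R, [/\ 0 < kappa0, 0 < C &
    forall A : set M, open A -> dbounded A -> forall kappa : R,
      0 < kappa <= kappa0 ->
      ((C * kappa)%:E * mu A <= mu (inner_collar A kappa))%E].

(* Elements of L^1 are represented by integrable functions, and all equalities,
   supports and convergences below are insensitive to null sets. *)
Definition L1 (g : M -> R) : Prop := mu.-integrable [set: M] (EFin \o g).

Definition supported_in (B : set M) (a : M -> R) : Prop :=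
  \forall x \ae mu, ~ B x -> a x = 0.

Definition atom_size (r : \bar R) (B : set M) (a : M -> R) : Prop :=
  match r with
  | p%:E =>
      (((mu B)^-1 * \int[mu]_(x in B) (`|a x| `^ p)%:E) `^ p^-1
        <= (mu B)^-1)%E
  | +oo%E => ('N[mu]_+oo[EFin \o a] <= (mu B)^-1)%E
  | -oo%E => False
  end.

Definition atom (r : \bar R) (B : set M) (a : M -> R) : Prop :=
  [/\ L1 a, supported_in B a, (\int[mu]_(x in B) (a x)%:E = 0)%E
    & atom_size r B a].

Definition atom_of_scale (r : \bar R) (b : R) (a : M -> R) : Prop :=
  exists (x : M) (s : R), 0 < s <= b /\ atom r (ball x s) a.

Definition atomic_decomposition (r : \bar R) (b : R) (g : M -> R)
    (lam : nat -> R) (a : nat -> M -> R) : Prop :=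
  [/\ forall k, atom_of_scale r b (a k),
      (\sum_(0 <= k <oo) `|lam k|%:E < +oo)%E
    & ('N[mu]_1[EFin \o (fun x => (g x - \sum_(k < n) lam k * a k x)%R)])%E
        @[n --> \oo] --> 0%E].

Definition H1 (r : \bar R) (b : R) (g : M -> R) : Prop :=
  L1 g /\ exists lam a, atomic_decomposition r b g lam a.

(* +oo when g has no decomposition *)
Definition H1_norm (r : \bar R) (b : R) (g : M -> R) : \bar R :=
  ereal_inf [set (\sum_(0 <= k <oo) `|lam k|%:E)%E | lam in
    [set lam | exists a, atomic_decomposition r b g lam a]].

End MetricMeasure.

Arguments approx_midpoint {R d} M R0 beta.

(* Main.v *)
(* Write phi_x for the indicator of the ball B(x, eta) divided by its measure.
   An atom a on a ball of radius in (c, b] is cut along a cover by N0 balls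
   B(x_j, eta); local doubling bounds N0 and makes the volumes of all the balls
   involved comparable. A piece g of integral m contributes the multiple
   g - m phi_(x_j) of an atom on B(x_j, eta), and the masses m, whose sum is 0,
   are carried to the centre x_0 along m (phi_(x_j) - phi_(x_0)). By the
   approximate midpoint property the distance between two points can be
   contracted by beta at the price of one intermediate point, until consecutive
   distances are at most c - eta, where R0 <= c - eta; then phi_x - phi_y is a
   multiple of an atom on B(x, c). So 2^k terms suffice when
   beta^k b <= c - eta. *)
Require Import Defs.
From HB Require Import structures.
From mathcomp Require Import all_boot all_order all_algebra.
From mathcomp Require Import all_classical all_reals all_analysis.
From mathcomp Require Import measurable_realfun ess_sup_inf.
From mathcomp Require Import ring lra.

Import Order.TTheory GRing.Theory Num.Theory.
Import numFieldNormedType.Exports.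

Local Open Scope classical_set_scope.
Local Open Scope ring_scope.

Set Implicit Arguments.
Unset Strict Implicit.
Unset Printing Implicit Defensive.

(** * Balls and their volumes *)

Section Geometry.
Context {R : realType} {d : measure_display} {M : metricMeasurableType R d}.

Lemma open_ballm (x : M) (s : R) : open (ball x s).
Proof.
rewrite openE => y; rewrite ballEmdist /= => xy.
apply/nbhs_ballP; exists (s - mdist x y) => /=; first by rewrite subr_gt0.
move=> z; rewrite ballEmdist /= => yz.
by rewrite (le_lt_trans (metric_triangle _ y _))// -ltrBrDl.
Qed.

Lemma measurable_ballm (hborel : borel_space M) (x : M) (s : R) :
  measurable (ball x s : set M).
Proof. by rewrite hborel; apply: sub_sigma_algebra; exact: open_ballm. Qed.

Lemma subset_ballm (x y : M) (s t : R) :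
  mdist x y + s <= t -> ball x s `<=` ball y t.
Proof.
move=> st z; rewrite !ballEmdist /= => xz.
rewrite (le_lt_trans (metric_triangle _ x _))// metric_sym.
by rewrite (lt_le_trans _ st)// ltrD2l.
Qed.

End Geometry.

(** * Consequences of local doubling: comparable volumes, packing and finite covers *)

Section BallVolume.
Context {R : realType} {d : measure_display} {M : metricMeasurableType R d}.
Variable mu : {measure set M -> \bar R}.
Hypothesis hborel : borel_space M.
Hypothesis hmu_pos : (0 < mu [set: M])%E.
Hypothesis hmu_ball : forall (x : M) (s : R), 0 < s -> (mu (ball x s) < +oo)%E.
Hypothesis hLDP : locally_doubling mu.

Definition vol (x : M) (s : R) : R := fine (mu (ball x s)).

Lemma volE (x : M) (s : R) : 0 < s -> mu (ball x s) = (vol x s)%:E.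
Proof. by move=> s0; rewrite /vol fineK// ge0_fin_numE// hmu_ball. Qed.

Lemma vol_ge0 (x : M) (s : R) : 0 <= vol x s.
Proof. exact: fine_ge0. Qed.

Lemma le_vol (x y : M) (s t : R) : 0 < s -> mdist x y + s <= t ->
  vol x s <= vol y t.
Proof.
move=> s0 st; have t0 : 0 < t.
  by rewrite (lt_le_trans s0)// (le_trans _ st)// lerDr mdist_ge0.
rewrite -lee_fin -!volE// le_measure ?inE//; first exact: measurable_ballm.
  exact: measurable_ballm.
exact: subset_ballm.
Qed.

Lemma vol_dilation (e : R) (k : nat) : 0 < e ->
  exists K : R, 1 <= K /\ forall x, vol x (2 ^+ k * e) <= K * vol x e.
Proof.
move=> e0; elim: k => [|k [K [K1 IH]]].
  by exists 1; split=> // x; rewrite expr0 !mul1r.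
have ke0 : 0 < 2 ^+ k * e by rewrite mulr_gt0// exprn_gt0.
have [D HD] := hLDP ke0.
(* Doubling gives no lower bound for [D]; the maximum keeps the factor at least 1. *)
exists (Num.max 1 D * K); split.
  by rewrite mulr_ege1// le_max lexx.
move=> x.
have := HD x (2 ^+ k * e); rewrite ke0 lexx => /(_ isT).
rewrite !volE ?mulr_gt0// -EFinM lee_fin exprS -mulrA => /le_trans; apply.
rewrite -mulrA (@le_trans _ _ (Num.max 1 D * vol x (2 ^+ k * e)))//.
  by rewrite ler_wpM2r ?vol_ge0// le_max lexx orbT.
by rewrite ler_wpM2l// le_max ler01.
Qed.

(** Both balls are compared with [ball y e]: it lies in [ball y s'], and a number of doublings fixed
    by [T / e] enlarges it to a ball containing [ball x s]. So one [K] serves all centres. *)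
Lemma vol_comparable (e T : R) : 0 < e -> exists K : R, 1 <= K /\
  forall x y s s', 0 < s -> mdist x y + s <= T -> e <= s' ->
    vol x s <= K * vol y s'.
Proof.
move=> e0; pose k := Num.bound `|T / e|.
have [K [K1 HK]] := vol_dilation k e0; exists K; split=> // x y s s' s0 sT es'.
have kT : T <= 2 ^+ k * e.
  rewrite -ler_pdivrMr// ltW// (le_lt_trans (ler_norm _))//.
  rewrite (lt_le_trans (archi_boundP _))// -natrX ler_nat.
  by rewrite ltnW// ltn_expl.
rewrite (le_trans (le_vol s0 (le_trans sT kT)))// (le_trans (HK y))//.
by rewrite ler_wpM2l ?(le_trans ler01)//; apply: le_vol; rewrite ?mdistxx ?add0r.
Qed.

(** If one ball were null, doubling would make every larger concentric ball null, and countably many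
    of these exhaust [M]. *)
Lemma vol_gt0 (x : M) (s : R) : 0 < s -> 0 < vol x s.
Proof.
move=> s0; rewrite lt_neqAle vol_ge0 andbT; apply/eqP => vx0.
suff : (mu [set: M] <= 0)%E by rewrite leNgt hmu_pos.
have -> : [set: M] = \bigcup_n (ball x n.+1%:R).
  apply/seteqP; split=> // y _; exists (Num.bound (mdist x y)) => //.
  rewrite ballEmdist /= (lt_trans (archi_boundP _))// ?mdist_ge0//.
  by rewrite ltr_nat.
apply: (le_trans (measure_sigma_subadditive mu
  (fun n => measurable_ballm hborel x n.+1%:R) _ (@subset_refl _ _))).
  by apply: bigcupT_measurable => n; exact: measurable_ballm.
rewrite eseries0// => n _ _; rewrite volE//; congr _%:E.
have [K [_ HK]] := vol_comparable n.+1%:R s0.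
apply/eqP; rewrite eq_le vol_ge0 andbT.
have := HK x x n.+1%:R s; rewrite mdistxx add0r -vx0 mulr0; exact.
Qed.

(** A packing argument: balls of radius [e / 2] about [e]-separated points are disjoint, lie in
    [ball x0 (T + e)], and each carries at least the fraction [K^-1] of its volume. So there are at
    most [K] of them, fewer than [Num.bound K]. *)
Lemma separated_card (e T : R) : 0 < e -> 0 < T -> exists N : nat,
  forall (x0 : M) (xs : nat -> M), (forall j, mdist (xs j) x0 < T) ->
  exists i j, [/\ (i < j < N)%N & mdist (xs i) (xs j) < e].
Proof.
move=> e0 T0; have e20 : 0 < e / 2 by rewrite divr_gt0.
have Te0 : 0 < T + e by rewrite addr_gt0.
(* The sum bounds the distance from [x0] to a point plus the radius [T + e] of the enclosing
   ball. *)
have [K [K1 HK]] := vol_comparable (T + (T + e)) e20.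
exists (Num.bound K) => x0 xs xsT; apply: contrapT => nsep.
have {}nsep i j : (i < j < Num.bound K)%N -> e <= mdist (xs i) (xs j).
  by move=> ij; rewrite leNgt; apply/negP => h; apply: nsep; exists i, j.
set n := Num.bound K in nsep.
have tI : trivIset [set k | (k < n)%N] (fun k => ball (xs k) (e / 2)).
  move=> i j /= ilt jlt [z []]; rewrite !ballEmdist /= => zi zj.
  wlog ij : i j ilt jlt zi zj / (i < j)%N.
    by move=> H; case: (ltngtP i j) => // ij; [exact: H|apply/esym; exact: H].
  have := nsep i j; rewrite ij jlt => /(_ isT); rewrite leNgt => /negP[].
  rewrite (le_lt_trans (metric_triangle _ z _))// [ltRHS]splitr ltrD//.
  by rewrite metric_sym.
have : (\sum_(i < n) mu (ball (xs i) (e / 2)) <= mu (ball x0 (T + e)))%E.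
  rewrite -(@measure_semi_additive_ord_I _ _ _ mu
    (fun k => ball (xs k) (e / 2)) n)//; last 2 first.
  - by move=> i _; exact: measurable_ballm.
  - by apply: bigsetU_measurable => i _; exact: measurable_ballm.
  apply: le_measure; rewrite ?inE//.
  - by apply: bigsetU_measurable => i _; exact: measurable_ballm.
  - exact: measurable_ballm.
  - rewrite -(bigcup_mkord n (fun k => ball (xs k) (e / 2))) => z [i _].
    apply: subset_ballm.
    rewrite lerD//; first exact: ltW.
    by rewrite ler_pdivrMr// ler_peMr ?ltW// ltr1n.
under eq_bigr do rewrite volE//.
rewrite volE// sumEFin lee_fin => sumle.
suff : n%:R <= K by rewrite leNgt archi_boundP// (le_trans ler01).
rewrite -(@ler_pM2r _ (vol x0 (T + e))) ?vol_gt0//.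
rewrite (@le_trans _ _ (K * \sum_(i < n) vol (xs i) (e / 2)))//; last first.
  by rewrite ler_wpM2l// (le_trans ler01).
rewrite mulr_sumr -[leLHS]/(n%:R * _) mulr_natl -[X in _ *+ X]card_ord.
rewrite -sumr_const ler_sum// => i _; apply: HK => //.
by rewrite lerD2r metric_sym ltW.
Qed.

(** Greedy choice: as long as the chosen points do not cover, an uncovered point extends the
    separated family. [N] such steps would contradict [separated_card]. *)
Lemma finite_cover (e T : R) : 0 < e -> 0 < T -> exists N : nat,
  forall x0 : M, exists xs : nat -> M, (forall j, mdist (xs j) x0 < T) /\
  forall y, mdist y x0 < T -> exists j, (j < N)%N /\ ball (xs j) e y.
Proof.
move=> e0 T0; have [N HN] := separated_card e0 T0; exists N => x0.
apply: contrapT => ncov.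
have sep n : (n <= N)%N -> exists xs : nat -> M, (forall j, mdist (xs j) x0 < T) /\
    forall i j, (i < j < n)%N -> e <= mdist (xs i) (xs j).
  elim: n => [_|n IH nN].
    by exists (fun=> x0); split=> [j|i j]; rewrite ?mdistxx// ltn0 andbF.
  have [xs [xsT xse]] := IH (ltnW nN).
  have [y [yT ny]] : exists y, mdist y x0 < T /\
      forall j, (j < n)%N -> e <= mdist (xs j) y.
    apply: contrapT => nex; apply: ncov; exists xs; split=> // y yT.
    apply: contrapT => nj; apply: nex; exists y; split=> // j jn.
    rewrite leNgt; apply/negP => h; apply: nj; exists j; rewrite ballEmdist.
    by rewrite (ltn_trans jn).
  (* Indices past [n] all receive [y], so that the whole sequence stays within distance [T] of
     [x0]. *)
  exists (fun k => if (k < n)%N then xs k else y); split=> [j|i j].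
    by case: ifP.
  rewrite ltnS => /andP[ij jn]; rewrite (leq_trans ij jn).
  by case: ifPn => [jn'|_]; [apply: xse; rewrite ij|apply: ny; exact: leq_trans jn].
have [xs [xsT xse]] := sep N (leqnn _).
have [i [j [ij]]] := HN x0 xs xsT.
by rewrite ltNge xse.
Qed.

End BallVolume.

(** * Rescaling atoms *)

Section AtomSize.
Context {R : realType} {d : measure_display} {M : metricMeasurableType R d}.
Variable mu : {measure set M -> \bar R}.
Hypothesis hmu_pos : (0 < mu [set: M])%E.

(* The size condition of an atom on a ball of measure v, without roots. *)
Definition size_le (r : \bar R) (v : R) (a : M -> R) : Prop :=
  match r with
  | p%:E => (\int[mu]_x (`|a x| `^ p)%:E <= (v `^ (1 - p))%:E)%E
  | +oo%E => \forall x \ae mu, `|a x| <= v^-1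
  | -oo%E => False
  end.

Lemma integral_supported (B : set M) (f : M -> \bar R) :
  (forall x, ~ B x -> f x = 0%E) ->
  (\int[mu]_(x in B) f x = \int[mu]_x f x)%E.
Proof.
move=> fB; rewrite integral_mkcond; apply: eq_integral => x _.
by rewrite patchE; case: ifPn => // /negP; rewrite inE => /fB.
Qed.

(** For finite [p], raising to the power [p] turns the bound on the mean into a bound of the
    integral by [v * v^-p]. Support in [B] allows integrating over all of [M]. *)
Lemma atom_sizeP (r : \bar R) (B : set M) (v : R) (a : M -> R) :
  (1 < r)%E -> 0 < v -> mu B = v%:E -> (forall x, ~ B x -> a x = 0) ->
  atom_size mu r B a <-> size_le r v a.
Proof.
move=> r1 v0 muB aB; case: r r1 => [p| |] //=; rewrite muB inver gt_eqF//.
- rewrite lte_fin => p1; have p0 : 0 < p by rewrite (lt_trans ltr01).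
  rewrite (@integral_supported B (fun x => (`|a x| `^ p)%:E)); last first.
    by move=> x /aB ->; rewrite normr0 powR0// gt_eqF.
  have : (0 <= \int[mu]_x (`|a x| `^ p)%:E)%E.
    by apply: integral_ge0 => x _; rewrite lee_fin powR_ge0.
  case: (\int[mu]_x (`|a x| `^ p)%:E)%E => [i| |]//=; rewrite ?lee_fin => i0.
  + have vi0 : 0 < v^-1 by rewrite invr_gt0.
    have e1 : v^-1 = (v^-1 `^ p) `^ p^-1.
      by rewrite -powRrM mulfV ?gt_eqF// powRr1// ltW.
    have e2 : v `^ (1 - p) = v * v^-1 `^ p.
      rewrite powRB ?(gt_eqF v0) ?implybT// powRr1 ?ltW//; congr (_ * _).
      by rewrite -(powR_inv1 (ltW v0)) -powRrM mulN1r powRN.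
    rewrite {2}e1 e2 -ler_pdivrMl//; split => [h|h].
      rewrite leNgt; apply/negP => H; move: h; rewrite leNgt => /negP; apply.
      by apply: gt0_ltr_powR; rewrite ?nnegrE ?powR_ge0 ?invr_gt0 ?mulr_ge0// ltW.
    by rewrite ge0_ler_powR ?nnegrE ?powR_ge0 ?invr_ge0 ?mulr_ge0// ltW.
  (* An infinite integral violates both conditions. *)
  + by rewrite gt0_muley ?lte_fin ?invr_gt0//= invr_eq0 gt_eqF// leye_eq.
(* By [hmu_pos] the [+oo] norm unfolds to an essential supremum. *)
- move=> _; rewrite unlock hmu_pos; split => [/ess_supP|h].
    by apply: filterS => x /=; rewrite lee_fin.
  by apply/ess_supP; apply: filterS h => x /=; rewrite lee_fin.
Qed.

End AtomSize.

(** * Operations on integrable functions *)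

Section L1Space.
Context {R : realType} {d : measure_display} {M : metricMeasurableType R d}.
Variable mu : {measure set M -> \bar R}.

Lemma L1_measurable (f : M -> R) : L1 mu f -> measurable_fun [set: M] f.
Proof. by move=> /measurable_int /measurable_EFinP. Qed.

Lemma L1D (f g : M -> R) : L1 mu f -> L1 mu g -> L1 mu (fun x => f x + g x).
Proof. by move=> f1 g1; apply: (integrableD measurableT f1 g1). Qed.

Lemma L1Z (c : R) (f : M -> R) : L1 mu f -> L1 mu (fun x => c * f x).
Proof. by move=> f1; apply: (integrableZl measurableT c f1). Qed.

Lemma L1B (f g : M -> R) : L1 mu f -> L1 mu g -> L1 mu (fun x => f x - g x).
Proof. by move=> f1 g1; apply: (integrableB measurableT f1 g1). Qed.

Lemma L1_sum (n : nat) (f : nat -> M -> R) : (forall k, L1 mu (f k)) ->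
  L1 mu (fun x => \sum_(k < n) f k x).
Proof.
move=> f1; elim: n => [|n IH].
  rewrite /L1 (_ : _ \o _ = cst 0%E); first exact: integrable0.
  by apply/funext => x /=; rewrite big_ord0.
rewrite (_ : (fun x => _) = (fun x => (\sum_(k < n) f k x) + f n x)).
  exact: L1D.
by apply/funext => x; rewrite big_ord_recr.
Qed.

Lemma L1_mul_indic (f : M -> R) (A : set M) : measurable A -> L1 mu f ->
  L1 mu (fun x => f x * \1_A x).
Proof.
move=> mA f1; apply: (le_integrable measurableT _ _ f1).
  apply/measurable_EFinP/measurable_funM; first exact: L1_measurable.
  exact: measurable_indic.
move=> x _ /=; rewrite lee_fin normrM indicE.
by case: (x \in A); rewrite ?normr1 ?normr0 ?mulr1 ?mulr0.
Qed.

Lemma L1_indic (A : set M) : measurable A -> (mu A < +oo)%E ->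
  L1 mu (\1_A : M -> R).
Proof.
move=> mA Afin; apply/integrableP; split.
  by apply/measurable_EFinP; exact: measurable_indic.
under eq_integral do rewrite /= ger0_norm//.
by rewrite integral_indic// setIT.
Qed.

Lemma Rintegral_indic (A : set M) : measurable A ->
  \int[mu]_x (\1_A x : R) = fine (mu A).
Proof. by move=> mA; rewrite /Rintegral integral_indic// setIT. Qed.

End L1Space.

Section ScaledAtom.
Context {R : realType} {d : measure_display} {M : metricMeasurableType R d}.
Variable mu : {measure set M -> \bar R}.
Hypothesis hmu_pos : (0 < mu [set: M])%E.

(** The maximum is one of its two arguments, so its power is at most the sum of their powers,
    without a convexity constant. *)
Lemma powR_normr_max_le (p t x y z : R) : 1 < p -> 0 <= t -> 0 <= y -> 0 <= z ->
  `|x| <= t * Num.max y z -> `|x| `^ p <= t `^ p * (y `^ p + z `^ p).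
Proof.
move=> p1 t0 y0 z0 xle; have p0 : 0 <= p by rewrite ltW// (lt_trans ltr01).
have m0 : 0 <= Num.max y z by rewrite le_max y0.
rewrite (@le_trans _ _ ((t * Num.max y z) `^ p))//.
  by rewrite ge0_ler_powR ?nnegrE// mulr_ge0.
rewrite powRM// ler_wpM2l ?powR_ge0//.
by rewrite maxEle; case: ifP; rewrite ?lerDl ?lerDr powR_ge0.
Qed.

(** The exponent [1 - p] is negative, so changing [v] to [v'] costs the factor [K^(p-1)]; then
    [K^(p-1) + 1 <= 2 K^p <= (2K)^p]. *)
Lemma powR_scale_le (p v v' K : R) : 1 < p -> 0 < v -> 0 < v' ->
  v' <= K * v -> 1 <= K ->
  ((2 * K)^-1) `^ p * (v `^ (1 - p) + v' `^ (1 - p)) <= v' `^ (1 - p).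
Proof.
move=> p1 v0 v'0 vK K1; have K0 : 0 < K by rewrite (lt_le_trans ltr01).
have p0 : 0 < p by rewrite (lt_trans ltr01).
have hK : v `^ (1 - p) <= K `^ (p - 1) * v' `^ (1 - p).
  rewrite -opprB !powRN ler_pdivlMr ?powR_gt0// ler_pdivrMl ?powR_gt0//.
  rewrite mulrC -powRM ?(ltW K0) ?(ltW v0)//.
  by rewrite ge0_ler_powR ?nnegrE ?mulr_ge0 ?subr_ge0// ltW.
have K2 : K `^ (p - 1) + 1 <= (2 * K) `^ p.
  rewrite powRM ?(ltW K0)// (@le_trans _ _ (2 * K `^ p))//; last first.
    by rewrite ler_wpM2r ?powR_ge0// le1r_powR ?ler1n ?(ltW p1).
  rewrite mulr_natl mulr2n lerD//; first by rewrite ler_powR// lerBlDr lerDl.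
  by rewrite -(powRr0 K) ler_powR// ltW.
rewrite (@le_trans _ _ ((2 * K)^-1 `^ p * ((2 * K) `^ p * v' `^ (1 - p))))//.
  rewrite ler_wpM2l ?powR_ge0// (le_trans (lerD hK (lexx _)))//.
  by rewrite -[X in _ + X]mul1r -mulrDl ler_wpM2r ?powR_ge0.
rewrite mulrA -powRM ?invr_ge0 ?mulr_ge0 ?(ltW K0)//.
by rewrite mulVf ?powR1 ?mul1r// gt_eqF// mulr_gt0.
Qed.

(** The criterion by which every new atom is recognized. In the factor [(2 * K)^-1], [K] pays for
    the change of volume from [v] to [v'] and 2 for the two arguments of the maximum. The factor
    does not involve [r], which keeps all later constants uniform in [r]. *)
Lemma atom_scaled (r : \bar R) (v v' K : R) (B : set M) (a h : M -> R) :
  (1 < r)%E -> 0 < v -> 0 < v' -> v' <= K * v -> 1 <= K ->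
  measurable B -> mu B = v'%:E -> measurable_fun [set: M] a -> size_le mu r v a ->
  L1 mu h -> (forall x, ~ B x -> h x = 0) -> \int[mu]_x h x = 0 ->
  (forall x, `|h x| <= (2 * K)^-1 * Num.max `|a x| v'^-1) ->
  atom mu r B h.
Proof.
move=> r1 v0 v'0 vK K1 mB muB ma sa h1 hB ih hle.
have K0 : 0 < K by rewrite (lt_le_trans ltr01).
split => //.
- by apply: aeW => x; exact: hB.
- rewrite (@integral_supported _ _ _ mu B (fun x => (h x)%:E)); last first.
    by move=> x /hB ->.
  by rewrite -[LHS]fineK ?(integrable_fin_num measurableT h1)//; congr EFin.
apply/(atom_sizeP hmu_pos r1 v'0 muB hB).
case: r r1 sa => [p| |]//= r1 sa; last first.
  apply: filterS sa => x sa; rewrite (le_trans (hle x))//.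
  rewrite ler_pdivrMl ?mulr_gt0// ge_max (le_trans sa).
    rewrite ler_peMl ?invr_ge0 ?(ltW v'0)//.
    by rewrite mulr_ege1// ler1n.
  rewrite ler_pdivlMr// ler_pdivrMl// mulrC (le_trans vK)//.
  by rewrite ler_wpM2r ?(ltW v0)// ler_peMl ?ler1n// ltW.
rewrite lte_fin in r1; have p0 : 0 < p by rewrite (lt_trans ltr01).
have mp (f : M -> R) : measurable_fun [set: M] f ->
    measurable_fun [set: M] (fun x => (`|f x| `^ p)%:E).
  move=> mf; apply/measurable_EFinP.
  apply: (@measurableT_comp _ _ _ _ _ _ (@powR R ^~ p)) => //.
  exact: measurableT_comp.
(* Integration is restricted to [B] first: there the constant arising from [v'^-1] has a finite
   integral. *)
rewrite -(@integral_supported _ _ _ mu B); last first.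
  by move=> x /hB ->; rewrite normr0 powR0// gt_eqF.
pose t := (2 * K)^-1 `^ p.
apply: (@le_trans _ _
  (\int[mu]_(x in B) (t%:E * ((`|a x| `^ p)%:E + (v'^-1 `^ p)%:E)))%E).
  apply: ge0_le_integral => //.
  - exact/measurable_funTS/(mp h)/(L1_measurable h1).
  - apply/measurable_funTS/emeasurable_funM => //.
    apply: emeasurable_funD => //; exact: mp a ma.
  - move=> x _; rewrite -EFinD -EFinM lee_fin.
    apply: powR_normr_max_le => //; rewrite invr_ge0 ?mulr_ge0//; exact/ltW.
rewrite ge0_integralZl_EFin//; first last.
- by rewrite powR_ge0.
- by apply: emeasurable_funD => //; exact/measurable_funTS/(mp a).
- by move=> x _; rewrite adde_ge0 // lee_fin powR_ge0.
rewrite ge0_integralD//; first last.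
- by move=> x _; rewrite lee_fin powR_ge0.
- exact/measurable_funTS/(mp a).
have -> : (\int[mu]_(x in B) (v'^-1 `^ p)%:E = (v' `^ (1 - p))%:E)%E.
  rewrite integral_cst// muB -EFinM; congr EFin.
  rewrite powRB ?(gt_eqF v'0) ?implybT// powRr1 ?(ltW v'0)// mulrC; congr (_ * _).
  by rewrite -(powR_inv1 (ltW v'0)) -powRrM mulN1r powRN.
apply: (@le_trans _ _ (t%:E * ((v `^ (1 - p))%:E + (v' `^ (1 - p))%:E))%E).
  rewrite lee_wpmul2l// ?lee_fin ?powR_ge0// leeD2r//.
  apply: le_trans sa; apply: ge0_subset_integral => //; exact: mp a ma.
rewrite -EFinD -EFinM lee_fin; exact: powR_scale_le.
Qed.

(* [|a| <= v^-1 + v^(p-1) |a|^p] replaces Hoelder's inequality, at the price of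
   the constant 2 instead of 1. *)
Lemma atom_size_L1_le (r : \bar R) (v : R) (B : set M) (a : M -> R) :
  (1 < r)%E -> 0 < v -> measurable B -> mu B = v%:E ->
  measurable_fun [set: M] a -> (forall x, ~ B x -> a x = 0) ->
  size_le mu r v a -> (\int[mu]_x `|a x|%:E <= 2%:E)%E.
Proof.
move=> r1 v0 mB muB ma aB sa.
have vi0 : 0 < v^-1 by rewrite invr_gt0.
have mna : measurable_fun [set: M] (fun x => `|a x|%:E).
  by apply/measurable_EFinP; exact: measurableT_comp.
rewrite -(@integral_supported _ _ _ mu B); last by move=> x /aB ->; rewrite normr0.
have iv : (\int[mu]_(x in B) v^-1%:E = 1)%E.
  by rewrite integral_cst// muB -EFinM mulVf// gt_eqF.
case: r r1 sa => [p| |]//= r1 sa; last first.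
  apply: (@le_trans _ _ 1%E); last by rewrite lee_fin ler1n.
  rewrite -iv; apply: ae_ge0_le_integral => //.
  - exact: measurable_funTS.
  - by move=> x _; rewrite lee_fin ltW.
  - by apply: filterS sa => x + _; rewrite lee_fin.
rewrite lte_fin in r1; have p0 : 0 < p by rewrite (lt_trans ltr01).
have mp : measurable_fun [set: M] (fun x => (`|a x| `^ p)%:E).
  apply/measurable_EFinP.
  apply: (@measurableT_comp _ _ _ _ _ _ (@powR R ^~ p)) => //.
  exact: measurableT_comp.
apply: (@le_trans _ _ (\int[mu]_(x in B)
    (v^-1%:E + (v `^ (p - 1))%:E * (`|a x| `^ p)%:E))%E).
  apply: ge0_le_integral => //.
  - exact: measurable_funTS.
  - apply: emeasurable_funD => //; apply: emeasurable_funM => //.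
    exact: measurable_funTS.
  move=> x _; rewrite -EFinM -EFinD lee_fin.
  have [ale|alt] := leP `|a x| v^-1.
    by rewrite (le_trans ale)// lerDl mulr_ge0 ?powR_ge0.
  have a0 : 0 < `|a x| by rewrite (lt_trans vi0).
  rewrite -(mulr_powRB1 (normr_ge0 _) p0) mulrCA.
  rewrite (@le_trans _ _ (`|a x| * (v `^ (p - 1) * `|a x| `^ (p - 1))))//; last first.
    by rewrite lerDr ltW.
  have one : 1 `^ (p - 1) = 1 :> R by rewrite powR1.
  rewrite ler_peMr// -powRM ?(ltW v0)// -[leLHS]one ge0_ler_powR ?nnegrE//.
  - by rewrite subr_ge0 ltW.
  - by rewrite mulr_ge0 ?ltW.
  - by rewrite -ler_pdivrMl// mulr1 ltW.
rewrite ge0_integralD//; first last.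
- by apply: emeasurable_funM => //; exact: measurable_funTS.
- by move=> x _; rewrite -EFinM lee_fin mulr_ge0 ?powR_ge0.
- by move=> x _; rewrite lee_fin ltW.
rewrite iv ge0_integralZl_EFin//; first last.
- by rewrite powR_ge0.
- exact: measurable_funTS.
rewrite -[2]/(1 + 1)%R [leRHS]EFinD leeD2l//.
apply: (@le_trans _ _ ((v `^ (p - 1))%:E * (v `^ (1 - p))%:E)%E).
  rewrite lee_wpmul2l// ?lee_fin ?powR_ge0//.
  by apply: le_trans sa; apply: ge0_subset_integral.
rewrite -EFinM lee_fin -powRD ?(gt_eqF v0) ?implybT//.
by rewrite -[1 - p]opprB subrr powRr0.
Qed.

End ScaledAtom.

(** * Finite combinations of atoms and transport of mass *)

Section AtomicCombination.
Context {R : realType} {d : measure_display} {M : metricMeasurableType R d}.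
Variables (mu : {measure set M -> \bar R}) (r : \bar R) (c : R).

(* [a] consists of atoms also beyond [N]: padding by zero coefficients then
   needs no other atom. *)
Definition atomic_comb (C : R) (N : nat) (f : M -> R) : Prop :=
  exists (l : nat -> R) (a : nat -> M -> R),
    [/\ forall k, atom_of_scale mu r c (a k), forall k, `|l k| <= C
      & \forall y \ae mu, f y = \sum_(k < N) l k * a k y].

Lemma atomic_comb_le (C C' : R) (N N' : nat) (f : M -> R) :
  C <= C' -> (N <= N')%N -> atomic_comb C N f -> atomic_comb C' N' f.
Proof.
move=> CC NN [l [a [ha hl hf]]].
exists (fun k => if (k < N)%N then l k else 0), a; split=> // [k|].
  case: ifP => _; first exact: le_trans CC.
  by rewrite normr0 (le_trans _ CC)// (le_trans _ (hl 0%N)).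
apply: filterS hf => y ->.
rewrite (big_ord_widen _ (fun k => l k * a k y) NN) big_mkcond /=.
by apply: eq_bigr => i _; case: ifP => _; rewrite ?mul0r.
Qed.

Lemma atomic_combD (C : R) (N1 N2 : nat) (f g : M -> R) :
  atomic_comb C N1 f -> atomic_comb C N2 g ->
  atomic_comb C (N1 + N2) (fun y => f y + g y).
Proof.
move=> [l1 [a1 [ha1 hl1 hf]]] [l2 [a2 [ha2 hl2 hg]]].
exists (fun k => if (k < N1)%N then l1 k else l2 (k - N1)%N),
  (fun k => if (k < N1)%N then a1 k else a2 (k - N1)%N).
split=> [k|k|]; [by case: ifP|by case: ifP|].
apply: filterS2 hf hg => y -> ->; rewrite big_split_ord /=.
congr (_ + _); apply: eq_bigr => i _; first by rewrite ltn_ord.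
by rewrite ltnNge leq_addr /= addKn.
Qed.

Lemma atomic_combZ (C L m : R) (N : nat) (f : M -> R) :
  `|m| <= L -> atomic_comb C N f -> atomic_comb (L * C) N (fun y => m * f y).
Proof.
move=> mL [l [a [ha hl hf]]]; exists (fun k => m * l k), a; split=> // [k|].
  by rewrite normrM ler_pM.
apply: filterS hf => y ->; rewrite mulr_sumr.
by apply: eq_bigr => i _; rewrite mulrA.
Qed.

Lemma atomic_comb_ae (C : R) (N : nat) (f g : M -> R) :
  (\forall y \ae mu, g y = f y) -> atomic_comb C N f -> atomic_comb C N g.
Proof.
move=> fg [l [a [ha hl hf]]]; exists l, a; split=> //.
by apply: filterS2 fg hf => y -> ->.
Qed.

Lemma atomic_comb1 (m : R) (f : M -> R) : m != 0 ->
  atom_of_scale mu r c (fun y => m^-1 * f y) -> atomic_comb `|m| 1 f.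
Proof.
move=> m0 hf; exists (fun=> m), (fun=> fun y => m^-1 * f y); split=> //.
by apply: aeW => y; rewrite big_ord1 mulrA mulfV// mul1r.
Qed.

(** The given combination only supplies the atoms that the definition requires even for an empty
    sum. *)
Lemma atomic_comb0 (C : R) (N : nat) (f : M -> R) :
  atomic_comb C N f -> atomic_comb C 0 (fun=> 0).
Proof.
move=> [l [a [ha hl _]]]; exists l, a; split=> //.
by apply: aeW => y; rewrite big_ord0.
Qed.

End AtomicCombination.

(** * Transport of mass between balls of radius [eta] *)

Section ScaleReduction.
Context {R : realType} {d : measure_display} {M : metricMeasurableType R d}.
Variable mu : {measure set M -> \bar R}.
Hypothesis hborel : borel_space M.
Hypothesis hmu_pos : (0 < mu [set: M])%E.
Hypothesis hmu_ball : forall (x : M) (s : R), 0 < s -> (mu (ball x s) < +oo)%E.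
Hypothesis hLDP : locally_doubling mu.

(** Taking [a = 0] in [atom_scaled] then handles functions bounded by a multiple of the reciprocal
    volume alone. *)
Lemma size_le0 (r : \bar R) (v : R) : (1 < r)%E -> 0 < v ->
  size_le mu r v (fun _ : M => 0).
Proof.
case: r => [p| |]//=; last first.
  by move=> _ v0; apply: aeW => x; rewrite normr0 invr_ge0 ltW.
rewrite lte_fin => p1 v0; rewrite integral0_eq ?lee_fin ?powR_ge0// => x _.
by rewrite normr0 powR0// gt_eqF// (lt_trans ltr01).
Qed.

(** Atoms vanish outside their ball only almost everywhere; this representative vanishes there
    everywhere, as the pointwise estimates require. *)
Lemma atom_restrict (r : \bar R) (B : set M) (a : M -> R) : measurable B ->
  atom mu r B a -> atom mu r B (fun x => a x * \1_B x) /\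
    \forall x \ae mu, a x = a x * \1_B x.
Proof.
move=> mB [a1 aB ia sa].
have eB x : B x -> a x * \1_B x = a x.
  by move=> Bx; rewrite indicE mem_set// mulr1.
have aae : \forall x \ae mu, a x = a x * \1_B x.
  apply: filterS aB => x aB; have [Bx|/[dup] nBx /aB ->] := pselect (B x).
    by rewrite eB.
  by rewrite mul0r.
split => //; split.
- exact: L1_mul_indic.
- by apply: aeW => x nBx; rewrite indicE memNset// mulr0.
- by rewrite -[RHS]ia; apply: eq_integral => x; rewrite inE => /eB ->.
case: r sa {aB} => [p| |]; rewrite /atom_size; last by [].
- suff -> : (\int[mu]_(x in B) (`|a x| `^ p)%:E =
    \int[mu]_(x in B) (`|a x * \1_B x| `^ p)%:E)%E by [].
  by apply: eq_integral => x; rewrite inE => /eB ->.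
- rewrite !unlock hmu_pos => h; apply: le_trans h; apply: le_ess_sup.
  by apply: filterS aae => x /= <-.
Qed.

Lemma atom_L1_le (r : \bar R) (x : M) (s : R) (a : M -> R) :
  (1 < r)%E -> 0 < s -> atom mu r (ball x s) a ->
  (\int[mu]_y `|a y|%:E <= 2%:E)%E.
Proof.
move=> r1 s0 ha; have mB := measurable_ballm hborel x s.
have [[a1 _ _ sa] aae] := atom_restrict mB ha.
have [ma _ _ _] := ha.
have v0 := vol_gt0 hborel hmu_pos hmu_ball hLDP x s0.
have muB := volE hmu_ball x s0.
have aB y : ~ ball x s y -> a y * \1_(ball x s) y = 0.
  by move=> nB; rewrite indicE memNset// mulr0.
have := atom_size_L1_le r1 v0 mB muB (L1_measurable a1) aB
  ((atom_sizeP hmu_pos r1 v0 muB aB).1 sa).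
apply: le_trans; rewrite le_eqVlt; apply/orP; left; apply/eqP.
apply: ge0_ae_eq_integral => //.
- exact/measurable_EFinP/measurableT_comp/(L1_measurable ma).
- exact/measurable_EFinP/measurableT_comp/(L1_measurable a1).
- by apply: filterS aae => y <-.
Qed.

Variables (eta c b : R).
Hypotheses (eta0 : 0 < eta) (etac : eta < c).

(* The normalized indicators [bump x] are the states between which the mass of
   an atom is transported. *)
Definition bump (x y : M) : R := (vol mu x eta)^-1 * \1_(ball x eta) y.

Let vol0 (x : M) (s : R) : 0 < s -> 0 < vol mu x s.
Proof. exact: vol_gt0. Qed.

Lemma L1_bump (x : M) : L1 mu (bump x).
Proof.
apply/L1Z/L1_indic; [exact: measurable_ballm|exact: hmu_ball].
Qed.

Lemma Rintegral_bump (x : M) : \int[mu]_y bump x y = 1.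
Proof.
have mB := measurable_ballm hborel x eta.
rewrite RintegralZl// ?Rintegral_indic//; last by apply: L1_indic => //; exact: hmu_ball.
by rewrite mulVf// gt_eqF// vol0.
Qed.

Lemma bump_ge0 (x y : M) : 0 <= bump x y.
Proof. by rewrite mulr_ge0// invr_ge0 vol_ge0. Qed.

Lemma bump_out (x y : M) : ~ ball x eta y -> bump x y = 0.
Proof. by move=> nB; rewrite /bump indicE memNset// mulr0. Qed.

Lemma bump_le (x y : M) : bump x y <= (vol mu x eta)^-1.
Proof.
rewrite /bump indicE ler_piMr ?invr_ge0 ?vol_ge0//.
by case: (_ \in _).
Qed.

Variable K : R.
Hypothesis K1 : 1 <= K.
Hypothesis volK : forall (x y : M) (s s' : R), 0 < s ->
  mdist x y + s <= b + 2 * c -> eta <= s' -> vol mu x s <= K * vol mu y s'.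
Hypothesis b0 : 0 < b.

Let K0 : 0 < K. Proof. exact: lt_le_trans K1. Qed.
Let c0 : 0 < c. Proof. exact: lt_trans etac. Qed.

(** Both bumps live in [ball x c], have mass 1 and are at most [K] over its volume. Their difference
    is at most [2 * K] over that volume, and the factor 1/2 in [atom_scaled] turns this into
    [4 * K]. *)
Lemma bumpB_comb1 (r : \bar R) (x y : M) : (1 < r)%E ->
  mdist x y <= c - eta -> atomic_comb mu r c (4 * K) 1 (fun z => bump x z - bump y z).
Proof.
move=> r1 xy; have K40 : 0 < 4 * K by rewrite mulr_gt0.
rewrite -(gtr0_norm K40); apply: atomic_comb1; first by rewrite gt_eqF.
exists x, c; rewrite c0 lexx; split=> //.
have v0 := vol0 x c0.
have iB : L1 mu (fun z => bump x z - bump y z) by apply: L1B; exact: L1_bump.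
have bK z w : mdist x z <= c - eta -> bump z w <= K * (vol mu x c)^-1.
  move=> xz; rewrite (le_trans (bump_le _ _))//.
  rewrite ler_pdivlMr// ler_pdivrMl ?vol0// mulrC.
  apply: volK => //; rewrite (le_trans (lerD xz (lexx _)))//.
  by rewrite [b + _]addrC; move: b0 c0 eta0; lra.
apply: (@atom_scaled _ _ _ mu hmu_pos r (vol mu x c) (vol mu x c) 1 _ (fun=> 0)) => //.
- by rewrite mul1r.
- exact: measurable_ballm.
- exact: volE.
- exact: size_le0.
- exact: L1Z.
- move=> z nz; rewrite !bump_out ?subrr ?mulr0// => h; apply: nz; move: h.
    by apply: subset_ballm; rewrite metric_sym -lerBrDr.
  by apply: subset_ballm; rewrite mdistxx add0r ltW.
- rewrite RintegralZl// RintegralB//; try exact: L1_bump.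
  by rewrite !Rintegral_bump subrr mulr0.
move=> z; rewrite normr0 normrM gtr0_norm ?invr_gt0// mulr1.
have -> : Num.max 0 (vol mu x c)^-1 = (vol mu x c)^-1.
  by apply/max_idPr; rewrite invr_ge0 ltW.
rewrite ler_pdivrMl//.
have -> : 4 * K * (2^-1 * (vol mu x c)^-1) =
  K * (vol mu x c)^-1 + K * (vol mu x c)^-1 by lra.
rewrite (le_trans (ler_normB _ _))// !ger0_norm ?bump_ge0// lerD// bK//.
by rewrite mdistxx subr_ge0 ltW.
Qed.

(** The centre [z] of the ball given by [hAMP] is the intermediate point: its distances to [x] and
    [y] are below [beta * mdist x y], so each half needs one contraction less. *)
Lemma bumpB_comb (R0 beta : R) (r : \bar R) (k : nat) (x y : M) :
  approx_midpoint M R0 beta -> 0 < beta -> R0 <= c - eta -> (1 < r)%E ->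
  beta ^+ k * mdist x y <= c - eta ->
  atomic_comb mu r c (4 * K) (2 ^ k) (fun z => bump x z - bump y z).
Proof.
move=> hAMP beta0 hR0 r1; elim: k x y => [|k IH] x y.
  by rewrite expr0 mul1r expn0; exact: bumpB_comb1.
(* Pairs at distance at most [R0], which [hAMP] does not treat, are joined by a single step since
   [R0 <= c - eta]. *)
move=> xy; have [xyR|Rxy] := leP (mdist x y) R0.
  apply: (@atomic_comb_le _ _ _ _ _ _ _ _ 1) (lexx _) _ _.
    by rewrite expn_gt0.
  by apply: bumpB_comb1 => //; exact: le_trans hR0.
have [z [s [s0 zx zy sxy]]] := hAMP x y Rxy.
have zk w : mdist z w < s -> beta ^+ k * mdist z w <= c - eta.
  move=> zw; apply: le_trans xy; rewrite exprSr -mulrA ler_wpM2l ?exprn_ge0 ?ltW//.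
  exact: lt_trans sxy.
rewrite ballEmdist /= in zx; rewrite ballEmdist /= in zy.
rewrite expnS mul2n -addnn.
have -> : (fun w => bump x w - bump y w) =
    (fun w => (bump x w - bump z w) + (bump z w - bump y w)).
  by apply/funext => w; rewrite addrA subrK.
by apply: atomic_combD; apply: IH; [rewrite metric_sym|]; exact: zk.
Qed.

(** * Cutting an atom along a cover by small balls *)

Section Localization.
Variables (r : \bar R) (x0 : M) (s : R) (a : M -> R) (n0 : nat).
Hypotheses (r1 : (1 < r)%E) (hs : c < s <= b).
Hypothesis ma : measurable_fun [set: M] a.
Hypothesis sa : size_le mu r (vol mu x0 s) a.
Hypothesis ia : (\int[mu]_y `|a y|%:E <= 2%:E)%E.

Lemma Rintegral_dominated_le (g : M -> R) : L1 mu g ->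
  (forall y, `|g y| <= `|a y|) -> `|\int[mu]_y g y| <= 2.
Proof.
move=> g1 ga; rewrite -lee_fin EFin_normr_Rintegral//.
apply: (le_trans (le_abse_integral mu measurableT (measurable_int mu g1))).
apply: le_trans ia; apply: ge0_le_integral => //.
- exact/measurable_EFinP/measurableT_comp/(L1_measurable g1).
- exact/measurable_EFinP/measurableT_comp.
- by move=> y _; rewrite lee_fin.
Qed.

(** The mass of [g] is at most 2, so the difference is bounded by three times the maximum of [|a|]
    and the reciprocal volume of [ball x eta]; [6 * K] is 3 times the [2 * K] of [atom_scaled]. *)
Lemma localized_comb1 (x : M) (g : M -> R) : mdist x x0 < b -> L1 mu g ->
  (forall y, `|g y| <= `|a y|) -> (forall y, ~ ball x eta y -> g y = 0) ->
  atomic_comb mu r c (6 * K) 1 (fun y => g y - (\int[mu]_z g z) * bump x y).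
Proof.
move=> xx0 g1 ga gx; set m := \int[mu]_z g z.
have K60 : 0 < 6 * K by rewrite mulr_gt0.
have m2 : `|m| <= 2 by exact: Rintegral_dominated_le.
rewrite -(gtr0_norm K60); apply: atomic_comb1; first by rewrite gt_eqF.
exists x, eta; rewrite eta0 (ltW etac); split=> //.
have /andP[cs sb] := hs; have s0 : 0 < s by exact: lt_trans cs.
have v0 := vol0 x eta0.
have mb1 : L1 mu (fun y => m * bump x y) by apply/L1Z/L1_bump.
apply: (@atom_scaled _ _ _ mu hmu_pos r (vol mu x0 s) (vol mu x eta) K _ a) => //.
- exact: vol0.
- apply: volK => //; last by rewrite ltW// (lt_trans etac).
  by move: xx0 etac c0 eta0; lra.
- exact: measurable_ballm.
- exact: volE.
- exact/L1Z/L1B.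
- by move=> y ny; rewrite gx// bump_out// mulr0 subrr mulr0.
- rewrite RintegralZl//; last exact: L1B.
  rewrite RintegralB// RintegralZl//; last exact: L1_bump.
  by rewrite Rintegral_bump mulr1 subrr mulr0.
move=> y; rewrite normrM gtr0_norm ?invr_gt0// ler_pdivrMl//.
set w := Num.max _ _.
have -> : 6 * K * ((2 * K)^-1 * w) = w + 2 * w by field; rewrite gt_eqF.
rewrite (le_trans (ler_normB _ _))// lerD//.
  by rewrite (le_trans (ga y))// le_max lexx.
rewrite normrM ler_pM// ger0_norm ?bump_ge0// (le_trans (bump_le _ _))//.
by rewrite le_max lexx orbT.
Qed.

(** Induction on the number of balls: the part of [g] in the last ball is split off, and the rest
    vanishes there. Each ball costs one atom for its piece and [n0] atoms for carrying its mass to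
    [x0]. For a function of integral 0 the subtracted term disappears. *)
Lemma localized_comb (xs : nat -> M) (n : nat) (g : M -> R) :
  (forall j, mdist (xs j) x0 < b) ->
  (forall j, atomic_comb mu r c (4 * K) n0 (fun z => bump (xs j) z - bump x0 z)) ->
  L1 mu g -> (forall y, `|g y| <= `|a y|) ->
  (forall y, (forall j, (j < n)%N -> ~ ball (xs j) eta y) -> g y = 0) ->
  atomic_comb mu r c (8 * K) (n * (n0 + 1))
    (fun y => g y - (\int[mu]_z g z) * bump x0 y).
Proof.
move=> xsb hxs; elim: n g => [|n IH] g g1 ga gx.
  have g0 y : g y = 0 by exact: gx.
  (* Without balls [g] is 0; the atoms for the empty sum come from [hxs]. *)
  have := atomic_comb0 (hxs 0%N); rewrite mul0n.
  move=> /(@atomic_comb_le _ _ _ _ _ _ _ (8 * K) _ 0); rewrite ler_pM2r// ler_nat.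
  move=> /(_ isT isT); apply: atomic_comb_ae; apply: aeW => y.
  rewrite g0 (_ : \int[mu]_z g z = 0) ?mul0r ?subrr//.
  by under eq_Rintegral do rewrite g0; rewrite Rintegral_cst// mul0r.
have mB := measurable_ballm hborel (xs n) eta.
pose g1B y := g y * \1_(ball (xs n) eta) y; pose g2 y := g y - g1B y.
have i1 : L1 mu g1B by exact: L1_mul_indic.
have i2 : L1 mu g2 by exact: L1B.
have h1 y : `|g1B y| <= `|g y|.
  rewrite /g1B normrM ler_piMr// indicE.
  by case: (_ \in _); rewrite ?normr1 ?normr0.
have h2 y : `|g2 y| <= `|g y|.
  rewrite /g2 /g1B -{1}[g y]mulr1 -mulrBr normrM ler_piMr// indicE.
  by case: (_ \in _); rewrite ?subrr ?subr0 ?normr1 ?normr0.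
have ig : \int[mu]_z g z = \int[mu]_z g2 z + \int[mu]_z g1B z.
  by rewrite -RintegralD//; apply: eq_Rintegral => y _; rewrite /g2 subrK.
have m2 : `|\int[mu]_z g1B z| <= 2.
  by apply: Rintegral_dominated_le => // y; exact: le_trans (ga y).
rewrite mulSnr; apply: (@atomic_comb_ae _ _ _ _ _ _ _ _ (fun y =>
   (g2 y - \int[mu]_z g2 z * bump x0 y) +
   ((\int[mu]_z g1B z) * (bump (xs n) y - bump x0 y) +
    (g1B y - \int[mu]_z g1B z * bump (xs n) y)))).
  by apply: aeW => y; rewrite ig /g2; ring.
apply: atomic_combD; [apply: IH => // |apply: atomic_combD].
- by move=> y; exact: le_trans (ga y).
- move=> y hy; rewrite /g2 /g1B indicE.
  have [By|nBy] := pselect (ball (xs n) eta y).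
    by rewrite mem_set// mulr1 subrr.
  rewrite memNset// mulr0 subr0; apply: gx => j; rewrite ltnS leq_eqVlt.
  by case/orP => [/eqP ->//|/hy].
(* The transported mass is at most 2 and a unit mass costs coefficients [4 * K]. *)
- have -> : 8 * K = 2 * (4 * K) by ring.
  by apply: atomic_combZ.
- apply: (@atomic_comb_le _ _ _ _ _ _ (6 * K) _ 1) => //.
    by rewrite ler_pM2r// ler_nat.
  apply: localized_comb1 => //.
    by move=> y; exact: le_trans (ga y).
  by move=> y nB; rewrite /g1B indicE memNset// mulr0.
Qed.

End Localization.
End ScaleReduction.

(** * From atoms to the Hardy space *)

Section Flattening.
Context {R : realType} {d : measure_display} {M : metricMeasurableType R d}.
Variable mu : {measure set M -> \bar R}.

Lemma Lnorm1_sum (s : seq nat) (f : nat -> M -> R) :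
  (forall k, L1 mu (f k)) ->
  ('N[mu]_1[EFin \o (fun x => \sum_(k <- s) f k x)%R] <=
   \sum_(k <- s) 'N[mu]_1[EFin \o f k])%E.
Proof.
move=> f1; have msum (t : seq nat) :
    measurable_fun [set: M] (fun x => \sum_(k <- t) f k x).
  by apply: measurable_sum => k; exact: (L1_measurable (f1 k)).
elim: s => [|k s IH].
  rewrite big_nil (_ : _ \o _ = cst 0%E) ?Lnorm0//.
  by apply/funext => x /=; rewrite big_nil.
rewrite big_cons (_ : (fun x => _) = (f k \+ (fun x => \sum_(k <- s) f k x))).
  apply: (le_trans (minkowski_EFin mu (L1_measurable (f1 k)) (msum s) (lexx _))).
  by rewrite leeD2l.
by apply/funext => x /=; rewrite big_cons.
Qed.

Lemma nneseries_le (u : nat -> R) (B : \bar R) : (forall k, 0 <= u k) ->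
  (forall n, (\sum_(0 <= k < n) (u k)%:E <= B)%E) ->
  (\sum_(0 <= k <oo) (u k)%:E <= B)%E.
Proof.
move=> u0 uB; apply: lime_le.
  by apply: is_cvg_nneseries => n _ _; rewrite lee_fin.
exact: nearW.
Qed.

Lemma sum_eucl_block (u : nat -> R) (N q : nat) (B : R) :
  (forall j, (j %/ N)%N = q -> u j <= B) -> (0 < N)%N ->
  \sum_(q * N <= j < q.+1 * N) u j <= N%:R * B.
Proof.
move=> uB N0; have -> : N%:R * B = \sum_(q * N <= j < q.+1 * N) B.
  by rewrite sumr_const_nat mulSn addnK mulr_natl.
rewrite !big_nat; apply: ler_sum => j /andP[qj jq]; apply: uB.
apply/eqP; rewrite eqn_leq -ltnS ltn_divLR// jq.
by rewrite leq_divRL.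
Qed.

(** Each [a k] is replaced by a block of [N] consecutive atoms. At the ends of blocks the new
    partial sums agree with the old ones; inside a block the deviation is controlled by one
    coefficient [lam q], which tends to 0. *)
Lemma atomic_decomposition_flatten (r : \bar R) (b c C : R) (N : nat)
    (g : M -> R) (lam : nat -> R) (a : nat -> M -> R) :
  0 <= C -> (0 < N)%N ->
  (forall f, atom_of_scale mu r c f -> ('N[mu]_1[EFin \o f] <= 2%:E)%E) ->
  (forall k, atomic_comb mu r c C N (a k)) -> L1 mu g ->
  atomic_decomposition mu r b g lam a ->
  exists (lam' : nat -> R) (a' : nat -> M -> R),
    atomic_decomposition mu r c g lam' a' /\
    (\sum_(0 <= k <oo) `|lam' k|%:E <=
     (C * N%:R)%:E * \sum_(0 <= k <oo) `|lam k|%:E)%E.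
Proof.
move=> C0 N0 atom2 acomb g1 [ha lamfin lamcvg].
have /choice[p hp] : forall k, exists p : (nat -> R) * (nat -> M -> R),
    [/\ forall i, atom_of_scale mu r c (p.2 i), forall i, `|p.1 i| <= C
      & \forall y \ae mu, a k y = \sum_(i < N) p.1 i * p.2 i y].
  by move=> k; have [l [al h]] := acomb k; exists (l, al).
(* Index [m] denotes the atom [m %% N] of block [m %/ N]. *)
pose lam' m := lam (m %/ N)%N * (p (m %/ N)%N).1 (m %% N)%N.
pose a' m := (p (m %/ N)%N).2 (m %% N)%N.
have ha' m : atom_of_scale mu r c (a' m) by have [h _ _] := hp (m %/ N)%N; exact: h.
have lam'le q j : (j %/ N)%N = q -> `|lam' j| <= C * `|lam q|.
  move=> jq; rewrite /lam' jq normrM mulrC ler_wpM2r//.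
  by have [_ h _] := hp q.
have L1a' m : L1 mu (a' m) by have [x [s [_ [h _ _ _]]]] := ha' m.
have L1a k : L1 mu (a k) by have [x [s [_ [h _ _ _]]]] := ha k.
have sumle : (\sum_(0 <= k <oo) `|lam' k|%:E <=
    (C * N%:R)%:E * \sum_(0 <= k <oo) `|lam k|%:E)%E.
  apply: nneseries_le => // n.
  apply: (@le_trans _ _ (\sum_(0 <= k < n * N) `|lam' k|%:E)%E).
    rewrite (big_cat_nat (leq0n n) (leq_pmulr n N0)) /= leeDl//.
    by apply: sume_ge0 => k _; rewrite lee_fin.
  rewrite sumEFin big_nat_mul.
  apply: (@le_trans _ _ (\sum_(0 <= q < n) (N%:R * (C * `|lam q|)))%:E).
    rewrite lee_fin; apply: ler_sum => q _; apply: sum_eucl_block => // j.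
    exact: lam'le.
  under eq_bigr do rewrite mulrA [N%:R * C]mulrC.
  rewrite -mulr_sumr EFinM lee_wpmul2l ?lee_fin ?mulr_ge0//.
  by rewrite -sumEFin; apply: nneseries_lim_ge => k _ _; rewrite lee_fin.
exists lam', a'; split => //; split => //.
  apply: le_lt_trans sumle _.
  rewrite lte_mul_pinfty ?lee_fin ?mulr_ge0//.
pose e q := ('N[mu]_1[EFin \o (fun x => (g x - \sum_(k < q) lam k * a k x)%R)])%E.
(* Countably many almost everywhere identities hold outside one common null set. *)
have blocks : \forall x \ae mu, forall q,
    \sum_(0 <= j < q * N) lam' j * a' j x = \sum_(k < q) lam k * a k x.
  have : \forall x \ae mu, forall k,
      a k x = \sum_(i < N) (p k).1 i * (p k).2 i x.
    by apply/ae_foralln => k; have [] := hp k.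
  apply: filterS => x hx q; rewrite big_nat_mul big_mkord.
  apply: eq_bigr => k _; rewrite hx mulr_sumr mulSn -{1}[(k * N)%N]add0n.
  rewrite big_addn addnK big_mkord; apply: eq_bigr => i _.
  rewrite /lam' /a' [(i + _)%N]addnC divnMDl// divn_small// addn0 modnMDl modn_small//.
  by rewrite mulrA.
(* The last term bounds the incomplete block: fewer than [N] atoms of norm at most 2, with
   coefficients at most [C] times that of the block. *)
have bound n : ('N[mu]_1[EFin \o (fun x => (g x - \sum_(k < n) lam' k * a' k x)%R)] <=
    e (n %/ N)%N + (2 * (N%:R * C))%:E * `|lam (n %/ N)%N|%:E)%E.
  set q := (n %/ N)%N.
  have qn : (q * N <= n)%N by exact: leq_trunc_div.
  have nq : (n <= q.+1 * N)%N by rewrite ltnW// -ltn_divLR.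
  pose f1 x := g x - \sum_(k < q) lam k * a k x.
  pose f2 x := \sum_(j <- index_iota (q * N) n) - lam' j * a' j x.
  have L1f1 : L1 mu f1.
    apply: L1B => //; apply: (@L1_sum _ _ _ mu q (fun k x => lam k * a k x)).
    by move=> k; exact: L1Z.
  have mf2 : measurable_fun [set: M] f2.
    by apply: measurable_sum => j; exact: L1_measurable (L1Z _ (L1a' j)).
  apply: (@le_trans _ _ 'N[mu]_1[EFin \o (f1 \+ f2)%R]%E).
    rewrite !Lnorm1; apply: ae_ge0_le_integral => //.
    - apply/measurable_EFinP/measurableT_comp => //.
      apply: measurable_funB; first exact: (L1_measurable g1).
      apply/(@L1_measurable _ _ _ mu)/(@L1_sum _ _ _ mu n (fun k x => lam' k * a' k x)).
      by move=> k; exact: L1Z.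
    - apply/measurable_EFinP/measurableT_comp => //.
      by apply: measurable_funD => //; exact: (L1_measurable L1f1).
    apply: filterS blocks => x hx _ /=.
    have -> : f2 x = - \sum_(q * N <= j < n) lam' j * a' j x.
      by rewrite -sumrN; apply: eq_bigr => j _; rewrite mulNr.
    rewrite /f1 -hx -(big_mkord xpredT (fun k => lam' k * a' k x)).
    by rewrite (big_cat_nat (leq0n _) qn) /= opprD addrA.
  apply: (le_trans (minkowski_EFin mu (L1_measurable L1f1) mf2 (lexx _))).
  rewrite leeD2l//.
  apply: (le_trans (Lnorm1_sum _ (fun j => L1Z (- lam' j) (L1a' j)))).
  apply: (@le_trans _ _ (\sum_(q * N <= j < n) (2 * `|lam' j|)%:E)%E).
    apply: lee_sum => j _; rewrite Lnorm1.
    under eq_integral do rewrite /= normrM normrN EFinM.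
    rewrite ge0_integralZl_EFin//; last first.
      exact/measurable_EFinP/measurableT_comp/(L1_measurable (L1a' j)).
    rewrite mulrC EFinM lee_wpmul2l// ?lee_fin//.
    by have := atom2 _ (ha' j); rewrite Lnorm1.
  rewrite sumEFin -EFinM lee_fin -mulr_sumr -!mulrA ler_wpM2l//.
  apply: (@le_trans _ _ (\sum_(q * N <= j < q.+1 * N) `|lam' j|)).
    by rewrite (big_cat_nat qn nq) /= lerDl sumr_ge0.
  by apply: sum_eucl_block => // j; exact: lam'le.
apply: (@squeeze_cvge _ _ _ _ (cst 0%E) _
  (fun n => e (n %/ N)%N + (2 * (N%:R * C))%:E * `|lam (n %/ N)%N|%:E)%E).
- by apply: nearW => n; rewrite Lnorm_ge0 bound.
- exact: cvg_cst.
have divN : (n %/ N)%N @[n --> \oo] --> \oo.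
  apply/cvgnyPge => A; exists (A * N)%N => // n /= An.
  by rewrite leq_divRL.
(* Each coefficient is at most the tail of the convergent series starting at it. *)
have lam0 : `|lam n|%:E @[n --> \oo] --> 0%E.
  apply: (@squeeze_cvge _ _ _ _ (cst 0%E) _
    (fun n => \sum_(n <= k <oo) `|lam k|%:E)%E).
  - apply: nearW => n; rewrite lee_fin normr_ge0 /=.
    have := @nneseries_lim_ge _ (fun k => `|lam k|%:E) xpredT n n.+1.
    by rewrite big_nat1; apply => k _ _; rewrite lee_fin.
  - exact: cvg_cst.
  - by apply: nneseries_tail_cvg => // k _; rewrite lee_fin.
rewrite -[X in _ --> X]add0e -{2}[0%E](mule0 (2 * (N%:R * C))%:E).
apply: cvgeD => //.
  exact: (cvg_comp _ _ divN lamcvg).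
apply: cvgeZl => //.
exact: (cvg_comp _ _ divN lam0).
Qed.
End Flattening.

(** * Comparison of the Hardy norms at two scales *)

Section HardyNorm.
Context {R : realType} {d : measure_display} {M : metricMeasurableType R d}.
Variable mu : {measure set M -> \bar R}.

Lemma atomic_decomposition_widen (r : \bar R) (c b : R) (g : M -> R)
    (lam : nat -> R) (a : nat -> M -> R) : c <= b ->
  atomic_decomposition mu r c g lam a -> atomic_decomposition mu r b g lam a.
Proof.
move=> cb [ha hlam hg]; split=> // k.
have [x [s [/andP[s0 sc] h]]] := ha k.
by exists x, s; rewrite s0 (le_trans sc cb).
Qed.

(** The positions with coefficient 0 are filled with [a] itself. *)
Lemma atomic_decomposition_atom (r : \bar R) (b : R) (a : M -> R) :
  atom_of_scale mu r b a ->
  atomic_decomposition mu r b a (fun k => (k == 0%N)%:R) (fun=> a) /\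
  (\sum_(0 <= k <oo) `|(k == 0%N)%:R : R|%:E <= 1)%E.
Proof.
move=> ha; have sum1 : (\sum_(0 <= k <oo) `|(k == 0%N)%:R : R|%:E <= 1)%E.
  apply: nneseries_le => // n; case: n => [|n]; first by rewrite big_geq.
  rewrite big_nat_recl//= normr1 big1 ?adde0// => k _.
  by rewrite normr0.
split=> //; split=> //; first by apply: le_lt_trans sum1 _; rewrite ltry.
apply: cvg_near_cst; exists 1%N => // n /= n1.
rewrite (_ : _ \o _ = cst 0%E) ?Lnorm0//; apply/funext => x /=.
case: n n1 => // n _; rewrite big_ord_recl /= mul1r big1 ?addr0 ?subrr// => k _.
by rewrite mul0r.
Qed.

Lemma H1_norm_widen (r : \bar R) (c b : R) (g : M -> R) : c <= b ->
  (H1_norm mu r b g <= H1_norm mu r c g)%E.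
Proof.
move=> cb; apply: ereal_inf_le_tmp; apply: image_subset => lam [a h].
by exists a; exact: atomic_decomposition_widen h.
Qed.

Lemma H1_norm_flatten (r : \bar R) (b c C : R) (N : nat) (g : M -> R)
    (lam : nat -> R) (a : nat -> M -> R) :
  0 <= C -> (0 < N)%N ->
  (forall f, atom_of_scale mu r c f -> ('N[mu]_1[EFin \o f] <= 2%:E)%E) ->
  (forall k, atomic_comb mu r c C N (a k)) -> L1 mu g ->
  atomic_decomposition mu r b g lam a ->
  (H1_norm mu r c g <= (C * N%:R)%:E * \sum_(0 <= k <oo) `|lam k|%:E)%E.
Proof.
move=> C0 N0 atom2 acomb g1 hg.
have [lam' [a' [h' hle]]] := atomic_decomposition_flatten C0 N0 atom2 acomb g1 hg.
apply: le_trans hle; apply: ereal_inf_lbound; exists lam' => //.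
by exists a'.
Qed.

End HardyNorm.

Lemma exists_expr_le (R : realType) (q eps B : R) : 0 < q < 1 -> 0 < eps ->
  0 < B -> exists k : nat, q ^+ k * B <= eps.
Proof.
move=> /andP[q0 q1] eps0 B0.
have q1' : `|q| < 1 by rewrite gtr0_norm.
have epsB : 0 < eps / B by rewrite divr_gt0.
have [k _ /(_ k (leqnn k)) /= h] := cvgr_lt 0 (cvg_expr q1') _ epsB.
by exists k; rewrite -ler_pdivlMr// ltW.
Qed.

(** [C] and [N] are chosen before [r] and [a]: they come from the volume comparison, the size of the
    cover and the number of contractions. *)
Lemma atom_scale_reduction (R : realType) (d : measure_display)
  (M : metricMeasurableType R d) (mu : {measure set M -> \bar R})
  (R0 beta b c : R) :
  borel_space M -> (0 < mu [set: M])%E ->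
  (forall (x : M) (s : R), 0 < s -> (mu (ball x s) < +oo)%E) ->
  locally_doubling mu -> approx_midpoint M R0 beta ->
  0 < beta < 1 -> R0 < c -> 0 < c -> 0 < b -> exists (C : R) (N : nat),
  [/\ 0 < C, (0 < N)%N & forall r a, (1 < r)%E -> atom_of_scale mu r b a ->
    atomic_comb mu r c C N a].
Proof.
move=> hborel mu0 muball hLDP hAMP beta01 R0c c0 b0.
have [eta [eta0 etac etaR0]] : exists eta, [/\ 0 < eta, eta < c & R0 <= c - eta].
  (* The first argument gives [eta < c], the second [R0 <= c - eta]. *)
  exists (Num.min (c / 2) ((c - R0) / 2)).
  split.
  - by rewrite lt_min !divr_gt0 ?subr_gt0.
  - by rewrite gt_min; apply/orP; left; move: c0; lra.
  - by rewrite lerBrDr -lerBrDl ge_min; apply/orP; right; move: R0c; lra.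
have /andP[beta0 beta1] := beta01.
have ce0 : 0 < c - eta by rewrite subr_gt0.
(* All cover centres lie within [b] of [x0], so [k] contractions make the steps short enough. *)
have [k hk] := exists_expr_le beta01 ce0 b0.
(* [b + 2 * c] accommodates both comparisons: [ball x c] with nearby balls of radius [eta], and
   balls of the cover with the original ball. *)
have [K [K1 volK]] := vol_comparable hborel muball hLDP (b + 2 * c) eta0.
have [N0 cover] := finite_cover hborel mu0 muball hLDP eta0 b0.
have K0 : 0 < K by exact: lt_le_trans K1.
(* The successor makes the count positive; it also leaves room for the single atom needed when
   [s <= c]. *)
exists (8 * K), (N0 * (2 ^ k + 1)).+1; split; rewrite ?mulr_gt0//.
move=> r a r1 [x0 [s [/andP[s0 sb] ha]]].
have [sc|cs] := leP s c.
  apply: (@atomic_comb_le _ _ _ _ _ _ `|1| _ 1) => //.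
    by rewrite normr1; move: K1; lra.
  apply: atomic_comb1; first exact: oner_neq0.
  exists x0, s; rewrite s0 sc; split=> //.
  by under eq_fun do rewrite invr1 mul1r.
have mB := measurable_ballm hborel x0 s.
have [[a1 _ ia sa] aae] := atom_restrict mu0 mB ha.
pose a' y := a y * \1_(ball x0 s) y.
have aB y : ~ ball x0 s y -> a' y = 0.
  by move=> nB; rewrite /a' indicE memNset// mulr0.
have v0 := vol_gt0 hborel mu0 muball hLDP x0 s0.
have muB := volE muball x0 s0.
have sa' := (atom_sizeP mu0 r1 v0 muB aB).1 sa.
have [xs [xsb xscov]] := cover x0.
apply: (atomic_comb_le (lexx _) (leqnSn _)).
apply: atomic_comb_ae aae _.
have ia' : \int[mu]_y a' y = 0.
  rewrite /Rintegral -(@integral_supported _ _ _ mu (ball x0 s)).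
    by rewrite ia.
  by move=> y /aB ->.
have := @localized_comb _ _ _ mu hborel mu0 muball hLDP eta c b eta0 etac K K1
  volK r x0 s a' (2 ^ k)%N r1 _ (L1_measurable a1) sa'
  (atom_size_L1_le r1 v0 mB muB (L1_measurable a1) aB sa') xs N0 a' xsb.
rewrite cs sb => /(_ isT); rewrite ia' => H.
apply: atomic_comb_ae (H _ a1 _ _).
- by apply: aeW => y; rewrite mul0r subr0.
- move=> j; apply: (bumpB_comb hborel mu0 muball hLDP eta0 etac K1 volK b0
    hAMP beta0 etaR0 r1).
  apply: le_trans hk; by rewrite ler_wpM2l ?exprn_ge0 ?(ltW beta0)// ltW.
- by [].
- move=> y ny; apply: aB; rewrite ballEmdist /= metric_sym => yx.
  have [j [jN jy]] := xscov y (lt_le_trans yx sb).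
  exact: ny jN jy.
Qed.

Theorem proposition4p3 (R : realType) (d : measure_display)
  (M : metricMeasurableType R d) (mu : {measure set M -> \bar R})
  (R0 beta b c : R)
  (hborel : borel_space M)
  (hunbounded : ~ dbounded [set: M])
  (hmu_pos : (0 < mu [set: M])%E)
  (hmu_ball : forall (x : M) (s : R), 0 < s -> (mu (ball x s) < +oo)%E)
  (hLDP : locally_doubling mu)
  (hI : isoperimetric mu)
  (hR0 : 0 <= R0) (hbeta : 1 / 2 < beta < 1)
  (hAMP : approx_midpoint M R0 beta)
  (hb : 0 < b) (hc : 0 < c)
  (hbc : R0 / (1 - beta) < c < b) :
  (exists (C : R) (N : nat), forall r : \bar R, (1 < r)%E ->
    forall (x : M) (s : R), 0 < s <= b ->
    forall a : M -> R, atom mu r (ball x s) a ->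
    exists n : nat, (n <= N)%N /\
    exists (a_ : 'I_n -> M -> R) (lam : 'I_n -> R),
      [/\ forall j, atom_of_scale mu r c (a_ j),
          forall j, `|lam j| <= C,
          \forall y \ae mu, a y = \sum_(j < n) lam j * a_ j y
        & (H1_norm mu r c a <= (C * N%:R)%:E)%E])
  /\
  (forall r : \bar R, (1 < r)%E ->
    (forall f : M -> R, H1 mu r c f <-> H1 mu r b f) /\
    exists C : R, forall f : M -> R, H1 mu r c f ->
      (H1_norm mu r b f <= H1_norm mu r c f)%E /\
      (H1_norm mu r c f <= C%:E * H1_norm mu r b f)%E).
Proof.
have /andP[beta2 beta1] := hbeta; have /andP[R0c cb] := hbc.
have beta01 : 0 < beta < 1 by rewrite beta1 andbT; move: beta2; lra.
(* Since [0 < 1 - beta <= 1], dividing the nonnegative [R0] by it does not decrease it. *)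
have {}R0c : R0 < c.
  apply: le_lt_trans R0c; rewrite ler_pdivlMr ?subr_gt0//.
  by rewrite ler_piMr// lerBlDr lerDl; case/andP: beta01 => /ltW.
have [C [N [C0 N0 hC]]] := atom_scale_reduction hborel hmu_pos hmu_ball hLDP
  hAMP beta01 R0c hc hb.
have atom2 r f : (1 < r)%E -> atom_of_scale mu r c f ->
    ('N[mu]_1[EFin \o f] <= 2%:E)%E.
  move=> r1 [x [s [/andP[s0 _] hf]]]; rewrite Lnorm1.
  exact: (atom_L1_le hborel hmu_pos hmu_ball hLDP r1 s0 hf).
split.
  exists C, N => r r1 x s sb a ha.
  have ab : atom_of_scale mu r b a by exists x, s.
  have acomb := hC r a r1 ab; have [l [al [hal hl hsum]]] := acomb.
  exists N; split=> //; exists (fun j => al j), (fun j => l j); split=> //.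
  have [hdec sum1] := atomic_decomposition_atom ab; have [a1 _ _ _] := ha.
  (* The atom is its own one-term decomposition at scale [b], of coefficient sum at most 1. *)
  apply: (le_trans (H1_norm_flatten (ltW C0) N0 (fun f => @atom2 r f r1)
    (fun=> acomb) a1 hdec)).
  by rewrite -[leRHS]mule1 lee_wpmul2l// lee_fin mulr_ge0// ltW.
move=> r r1; split=> [f|].
  split=> -[f1 [lam [a h]]]; split=> //.
    by exists lam, a; apply: atomic_decomposition_widen h; exact: ltW.
  have [ha _ _] := h.
  have [lam' [a' [h' _]]] := atomic_decomposition_flatten (ltW C0) N0
    (fun f => @atom2 r f r1) (fun k => hC r (a k) r1 (ha k)) f1 h.
  by exists lam', a'.
exists (C * N%:R) => f [f1 _]; split; first by apply: H1_norm_widen; exact: ltW.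
(* Moving the positive constant to the left turns the claim into a lower bound for an infimum,
   verified on each decomposition at scale [b]. *)
rewrite -lee_pdivrMl ?mulr_gt0 ?ltr0n//.
apply: le_ereal_inf_tmp => _ /= [lam [a h] <-].
rewrite lee_pdivrMl ?mulr_gt0 ?ltr0n//; have [ha _ _] := h.
exact: H1_norm_flatten (ltW C0) N0 (fun f => @atom2 r f r1)
  (fun k => hC r (a k) r1 (ha k)) f1 h.
Qed.
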